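(* Let $\gamma_1(t)=e^{-\pi t^2}$ and $\gamma_2(t)=2\pi t\,e^{-\pi t^2}$ for $t\in\mathbb{R}$. Let $\varphi,\psi\in L^2(\mathbb{R})$ satisfy $|\mathcal{F}[\gamma_1\varphi](\xi)|=|\mathcal{F}[\gamma_1\psi](\xi)|$ and $|\mathcal{F}[\gamma_2\varphi](\xi)|=|\mathcal{F}[\gamma_2\psi](\xi)|$ for all $\xi\in\mathbb{R}$. Then there exists $c\in\mathbb{C}$ with $|c|=1$ such that either $\psi=c\varphi$ or $\psi=c\varphi^*$, where $\varphi^*(x)=\overline{\varphi(-x)}$.
   Context: The Fourier transform is normalized as $\mathcal{F}f(\xi)=\hat f(\xi)=\int_{\mathbb{R}}f(x)e^{-2\pi i x\xi}\,dx$ for $f\in L^1(\mathbb{R})$, extended to $L^2(\mathbb{R})$ in the usual way. Equalities of functions in $L^2$ are understood almost everywhere. *)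

(* Defs.v *)
From HB Require Import structures.
From mathcomp Require Import all_boot all_order all_algebra.
From mathcomp Require Import all_classical all_reals all_analysis.
From mathcomp Require Import complex.
Set Implicit Arguments. Unset Strict Implicit. Unset Printing Implicit Defensive.
Import Order.TTheory GRing.Theory Num.Theory.
Local Open Scope classical_set_scope.
Local Open Scope ring_scope.

Section Defs.
Variable R : realType.

Definition leb := (@lebesgue_measure R).

Definition isL2 (f : R -> R[i]) : Prop :=
  [/\ measurable_fun setT (fun x => complex.Re (f x)),
      measurable_fun setT (fun x => complex.Im (f x)) &
      (\int[leb]_x (complex.Re (f x) ^+ 2 + complex.Im (f x) ^+ 2)%:E < +oo)%E].

(* Fourier transform  \hat f(xi) = \int f(x) e^{-2 pi i x xi} dx,
   written out via real and imaginary parts: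
   f(x) e^{-i t} = (u cos t + v sin t) + i (v cos t - u sin t), f = u + i v. *)
Definition fourier (f : R -> R[i]) (xi : R) : R[i] :=
  Complex
    (Rintegral leb setT (fun x =>
       complex.Re (f x) * cos (2 * pi * x * xi)
       + complex.Im (f x) * sin (2 * pi * x * xi)))
    (Rintegral leb setT (fun x =>
       complex.Im (f x) * cos (2 * pi * x * xi)
       - complex.Re (f x) * sin (2 * pi * x * xi))).

Definition gamma1 (t : R) : R := expR (- (pi * t ^+ 2)).
Definition gamma2 (t : R) : R := 2 * pi * t * expR (- (pi * t ^+ 2)).

Definition rmulf (g : R -> R) (f : R -> R[i]) : R -> R[i] :=
  fun x => (Complex (g x) 0 * f x)%R.

Definition reflconj (f : R -> R[i]) : R -> R[i] :=
  fun x => conjc (f (- x)).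

End Defs.

(* Main.v *)
(** With F = F[gamma1 phi] and G = F[gamma1 psi], the transforms of gamma2 phi and
    gamma2 psi are iF' and iG', so the hypotheses read |F| = |G| and |F'| = |G'|
    on the real line.  Differentiating |F|^2 = |G|^2 gives
    Re (F' F^* ) = Re (G' G^* ), hence Im (F' F^* ) = +- Im (G' G^* ) pointwise, with a
    constant sign on some interval where F does not vanish.  On it the logarithmic
    derivative of G is that of F or of its conjugate, so G = c F or G = c F^*.
    The Gaussian factor makes F and G restrictions of entire functions, so the
    identity persists on the whole line, and injectivity of the Fourier
    transform on L^1 concludes.

    Injectivity is proved without convolutions: if all frequencies of a vanish,
    then a is orthogonal to the trigonometric polynomials, bounded sequences of
    which converge pointwise to the indicator function of a half-line; so every
    primitive of a is zero, and Lebesgue differentiation gives a = 0. *)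

Require Import Defs.
From HB Require Import structures.
From mathcomp Require Import all_boot all_order all_algebra.
From mathcomp Require Import all_classical all_reals all_analysis.
From mathcomp Require Import measurable_realfun complex ring lra.
Set Implicit Arguments. Unset Strict Implicit. Unset Printing Implicit Defensive.
Import Order.TTheory GRing.Theory Num.Theory.
Import numFieldNormedType.Exports.
Local Open Scope classical_set_scope.
Local Open Scope ring_scope.

(** * Derivatives and Taylor bounds *)

Section RealCalculus.
Context {R : realType}.
Implicit Types (f g df : R -> R) (a b x y : R).

Lemma is_derive1D f g x (a b : R) : is_derive x 1 f a -> is_derive x 1 g b ->
  is_derive x 1 (fun y => f y + g y) (a + b).
Proof. exact: is_deriveD. Qed.

Lemma is_derive1B f g x (a b : R) : is_derive x 1 f a -> is_derive x 1 g b ->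
  is_derive x 1 (fun y => f y - g y) (a - b).
Proof. exact: is_deriveB. Qed.

Lemma is_derive1M f g x (a b : R) : is_derive x 1 f a -> is_derive x 1 g b ->
  is_derive x 1 (fun y => f y * g y) (f x * b + g x * a).
Proof. exact: is_deriveM. Qed.

Lemma is_derive1V f x (a : R) : f x != 0 -> is_derive x 1 f a ->
  is_derive x 1 (fun y => (f y)^-1) (- (f x) ^- 2 * a).
Proof. exact: is_deriveV. Qed.

Lemma is_derive1X f n x (a : R) : is_derive x 1 f a ->
  is_derive x 1 (fun y => f y ^+ n) (n%:R * f x ^+ n.-1 * a).
Proof.
move=> fa; rewrite (_ : (fun y => _) = f ^+ n); first exact: is_deriveX.
by apply/funext => y; rewrite exprfctE.
Qed.

Lemma derive_continuous f df :
  (forall x, is_derive x 1 f (df x)) -> continuous f.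
Proof.
move=> fdf x; apply/differentiable_continuous/derivable1_diffP.
by have [] := fdf x.
Qed.

(** The endpoints are unordered and derivability is asked only on the closed ball around [a] through
    [b], so the lemma applies inside balls. The conclusion [c != a] lets Cauchy's argument cancel a
    power of the distance from [c] to [a]. *)
Lemma MVT_between f df a b : a != b ->
    (forall x, `|x - a| <= `|b - a| -> is_derive x 1 f (df x)) ->
  exists c, [/\ c != a, `|c - a| <= `|b - a| & f b - f a = df c * (b - a)].
Proof.
move=> ab fdf.
have cts u v : (forall x, x \in `[u, v] -> `|x - a| <= `|b - a|) ->
    {within `[u, v], continuous f}.
  move=> uv; apply: derivable_within_continuous => x /uv /fdf xd.
  exact: ex_derive.
have [altb|blta|/eqP] := ltgtP a b; last by rewrite (negbTE ab).
- have le x : x \in `[a, b] -> `|x - a| <= `|b - a|.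
    rewrite in_itv/= => /andP[ax xb].
    by rewrite !ger0_norm ?subr_ge0// ?lerD2r// ltW.
  have [|c cab E] := @MVT R f df a b altb _ (cts _ _ le).
    by move=> x xab; apply/fdf/le; exact: subset_itv_oo_cc xab.
  exists c; split=> //; last exact/le/subset_itv_oo_cc.
  by move: cab; rewrite in_itv/= => /andP[/gt_eqF ->].
- have le x : x \in `[b, a] -> `|x - a| <= `|b - a|.
    rewrite in_itv/= => /andP[bx xa].
    by rewrite !ler0_norm ?subr_le0// ?lerN2 ?lerD2r// ltW.
  have [|c cab E] := @MVT R f df b a blta _ (cts _ _ le).
    by move=> x xab; apply/fdf/le; exact: subset_itv_oo_cc xab.
  exists c; split=> //; last by rewrite -opprB E -mulrN opprB.
    by move: cab; rewrite in_itv/= => /andP[_ /lt_eqF ->].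
  exact/le/subset_itv_oo_cc.
Qed.

Lemma ball_derive0_cst f a r :
  (forall x, ball a r x -> is_derive x 1 f 0) ->
  forall x, ball a r x -> f x = f a.
Proof.
move=> f0 x axr; have [->//|xa] := eqVneq a x.
have [|c [_ _]] := @MVT_between f (cst 0) a x xa.
  move=> y yx; apply: f0; apply: le_lt_trans axr.
  by rewrite distrC (distrC a).
by rewrite mul0r => /subr0_eq.
Qed.

(** Each integration gains a factor [n.+1]; iterating builds the factorial of Taylor's bound without
    any integral remainder. *)
Lemma norm_le_pow_primitive f df a n (M : R) :
    (forall x, is_derive x 1 f (df x)) -> f a = 0 ->
    (forall x, `|df x| <= M * `|x - a| ^+ n) ->
  forall x, `|f x| <= M / n.+1%:R * `|x - a| ^+ n.+1.
Proof.
move=> fdf fa dfM x; have [<-|ax] := eqVneq a x.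
  by rewrite fa subrr !normr0 expr0n/= mulr0.
(* Cauchy's mean value theorem against the monomial of degree n+1 *)
pose h y := f y * (x - a) ^+ n.+1 - f x * (y - a) ^+ n.+1.
pose dh y := df y * (x - a) ^+ n.+1 - f x * (n.+1%:R * (y - a) ^+ n).
have hdh y : is_derive y 1 h (dh y).
  have ya : is_derive y 1 (fun z : R => z - a) (1 - 0).
    exact: is_derive1B.
  have := is_derive1B
    (is_derive1M (fdf y) (is_derive_cst ((x - a) ^+ n.+1) y 1))
    (is_derive1M (is_derive_cst (f x) y 1)
      (is_derive1X n.+1 ya)).
  by move/is_derive_eq; apply; rewrite /dh/= /cst; ring.
have [c [ca _]] := @MVT_between h dh a x ax (fun y _ => hdh y).
have -> : h x = 0 by rewrite /h subrr.
have -> : h a = 0 by rewrite /h fa subrr expr0n/= mulr0 mul0r subrr.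
rewrite subrr => /esym/eqP.
rewrite mulf_eq0 [x - a == 0]subr_eq0 [x == a]eq_sym (negbTE ax) orbF.
rewrite /dh subr_eq0 => /eqP E.
have : `|f x| * (n.+1%:R * `|c - a| ^+ n) <=
       M * `|c - a| ^+ n * `|x - a| ^+ n.+1.
  rewrite -!normrX -[n.+1%:R]normr_nat -!normrM -E normrM normrX.
  by apply: ler_wpM2r; rewrite ?exprn_ge0// normrX.
have c0 : 0 < `|c - a| ^+ n by rewrite exprn_gt0// normr_gt0 subr_eq0.
rewrite mulrA [X in _ <= X](_ : _ = M * `|x - a| ^+ n.+1 * `|c - a| ^+ n).
  by rewrite ler_pM2r// -ler_pdivlMr// mulrAC.
by rewrite mulrAC.
Qed.

Lemma norm_le_taylor (D : nat -> R -> R) a n (M : R) :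
    (forall k x, is_derive x 1 (D k) (D k.+1 x)) ->
    (forall k, (k < n)%N -> D k a = 0) ->
    (forall x, `|D n x| <= M) ->
  forall x, `|D 0%N x| <= M / n`!%:R * `|x - a| ^+ n.
Proof.
elim: n D => [|n IHn] D dD D0 DM x.
  by rewrite expr0 mulr1 fact0 divr1.
have := @norm_le_pow_primitive (D 0%N) (D 1%N) a n (M / n`!%:R).
rewrite -mulrA -invfM -natrM [(n`! * _)%N]mulnC -factS; apply => //.
- exact: D0.
- move=> y; apply: (IHn (fun k => D k.+1)) => // k kn.
  exact: D0.
Qed.

Lemma near_derive_eq0 f df a : (forall x, is_derive x 1 f (df x)) ->
  (\forall x \near a, f x = 0) -> \forall x \near a, df x = 0.
Proof.
move=> fdf /near_join; apply: filterS => x nx.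
have := @near_eq_derive R R R f (cst 0) x 1 nx.
by rewrite derive_cst => <-; have fx := fdf x; rewrite derive_val.
Qed.

(** A bound for every [K > 0] means that Taylor expansions have infinite radius, so a single
    expansion at [a], where all derivatives vanish, reaches every [x]. *)
Lemma vanish_near_entire (D : nat -> R -> R) a :
    (forall k x, is_derive x 1 (D k) (D k.+1 x)) ->
    (forall K : R, 0 < K -> exists C : R, forall n x,
       `|D n x| <= C * K ^+ n * n`!%:R) ->
    (\forall x \near a, D 0%N x = 0) -> forall x, D 0%N x = 0.
Proof.
move=> dD DC Da x.
have Dk k : \forall y \near a, D k y = 0.
  by elim: k => // k IH; exact: near_derive_eq0 IH.
have {Da} D0 k : D k a = 0 by exact: nbhs_singleton (Dk k).
(* With this [K] the product of [K] and the distance from [x] to [a] is at most 1/2, so the Taylor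
   bound of order [n] decays geometrically. *)
pose K : R := (2 * (1 + `|x - a|))^-1.
have K0 : 0 < K by rewrite invr_gt0 mulr_gt0// ltr_wpDr.
have [C CD] := DC _ K0.
have C0 : 0 <= C.
  by have := CD 0%N x; rewrite expr0 !mulr1; apply: le_trans.
have bound n : `|D 0%N x| <= C * (2^-1) ^+ n.
  apply: (le_trans (norm_le_taylor (D := D) (M := C * K ^+ n * n`!%:R)
    dD (fun k _ => D0 k) (CD n) x)).
  rewrite mulfK ?pnatr_eq0 -?lt0n ?fact_gt0// -mulrA -exprMn ler_wpM2l//.
  have x0 : 0 <= `|x - a| by [].
  rewrite lerXn2r ?nnegrE ?(mulr_ge0 (ltW K0) x0) ?invr_ge0//.
  by rewrite /K mulrC ler_pdivrMr ?mulr_gt0 ?ltr_wpDr//; lra.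
apply/normr0_eq0/eqP; rewrite eq_le normr_ge0 andbT.
have cC : C * (2^-1) ^+ n @[n --> \oo] --> C * 0.
  by apply: cvgMl_tmp; apply: cvg_expr; rewrite ger0_norm// invf_lt1// ltr1n.
rewrite mulr0 in cC.
by apply: (ler_cvg_to (cvg_cst _) cC); exact: nearW.
Qed.

End RealCalculus.

(** * Functions with equal modulus and equal speed *)

Section Phase.
Context {R : realType}.
Variables A B A' B' C D C' D' : R -> R.
Hypothesis dA : forall x : R, is_derive x 1 A (A' x).
Hypothesis dB : forall x : R, is_derive x 1 B (B' x).
Hypothesis dC : forall x : R, is_derive x 1 C (C' x).
Hypothesis dD : forall x : R, is_derive x 1 D (D' x).
Hypothesis eq_mod : forall x, A x ^+ 2 + B x ^+ 2 = C x ^+ 2 + D x ^+ 2.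

Lemma eq_radial_derivative (x : R) : A x * A' x + B x * B' x = C x * C' x + D x * D' x.
Proof.
have dsq (f g : R -> R) (f' g' : R) : is_derive x 1 f f' -> is_derive x 1 g g' ->
    is_derive x 1 (fun y => f y ^+ 2 + g y ^+ 2) (2 * (f x * f' + g x * g')).
  move=> df dg; have := is_derive1D
    (is_derive1X 2 df) (is_derive1X 2 dg).
  by move/is_derive_eq; apply; rewrite /=; ring.
have [_ E1] := dsq _ _ _ _ (dA x) (dB x); have [_ E2] := dsq _ _ _ _ (dC x) (dD x).
have : (fun y => A y ^+ 2 + B y ^+ 2) = (fun y => C y ^+ 2 + D y ^+ 2).
  exact/funext.
by move=> E; rewrite E E2 in E1; lra.
Qed.

(* With F = A + iB and G = C + iD, the hypotheses say that F' / F = G' / G on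
   the ball, so that G / F is constant there. *)
Lemma proportional_on_ball (x0 r : R) : 0 < r ->
    (forall x : R, ball x0 r x -> A x ^+ 2 + B x ^+ 2 != 0) ->
    (forall x : R, ball x0 r x ->
       A x * B' x - B x * A' x = C x * D' x - D x * C' x) ->
  exists u v : R, u ^+ 2 + v ^+ 2 = 1 /\ forall x : R, ball x0 r x ->
    C x = u * A x - v * B x /\ D x = u * B x + v * A x.
Proof.
move=> r0 N0 PQ.
pose N x := A x ^+ 2 + B x ^+ 2.
(* [U] and [V] are the real and imaginary parts of G / F, written as G times the conjugate of F over
   |F|^2. *)
pose U x := (C x * A x + D x * B x) * (N x)^-1.
pose V x := (D x * A x - C x * B x) * (N x)^-1.
have dN (x : R) : is_derive x 1 N (2 * (A x * A' x + B x * B' x)).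
  have := is_derive1D
    (is_derive1X 2 (dA x)) (is_derive1X 2 (dB x)).
  by move/is_derive_eq; apply; rewrite /=; ring.
(* With [E] and [P] the real and imaginary parts of F' times the conjugate of F, these formulas say
   F' = F (E + iP) / N and G' = G (E + iP) / N. Substituting them reduces U' = V' = 0 to an
   algebraic identity. *)
have solve (x : R) : ball x0 r x ->
   let E := A x * A' x + B x * B' x in let P := A x * B' x - B x * A' x in
   [/\ A' x = (A x * E - B x * P) / N x, B' x = (B x * E + A x * P) / N x,
       C' x = (C x * E - D x * P) / N x & D' x = (D x * E + C x * P) / N x].
  move=> xr E P; have Nx := N0 x xr; have N2 : N x = C x ^+ 2 + D x ^+ 2.
    exact: eq_mod.
  have N2x : C x ^+ 2 + D x ^+ 2 != 0 by rewrite -N2.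
  split; [rewrite /E /P /N; field; exact: Nx| rewrite /E /P /N; field; exact: Nx| |];
    rewrite /E /P PQ// (eq_radial_derivative x) N2; field; exact: N2x.
have dU (x : R) : ball x0 r x -> is_derive x 1 U 0.
  move=> xr; have := is_derive1M
     (is_derive1D (is_derive1M (dC x) (dA x))
                            (is_derive1M (dD x) (dB x)))
     (is_derive1V (f := N) (N0 x xr) (dN x)).
  move/is_derive_eq; apply.
  have [eA eB eC eD] := solve x xr; have := N0 x xr.
  move: eA eB eC eD; rewrite /N.
  set E := A x * A' x + B x * B' x; set P := A x * B' x - B x * A' x.
  by move=> -> -> -> -> Nx; field.
have dV (x : R) : ball x0 r x -> is_derive x 1 V 0.
  move=> xr; have := is_derive1M
     (is_derive1B (is_derive1M (dD x) (dA x))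
                            (is_derive1M (dC x) (dB x)))
     (is_derive1V (f := N) (N0 x xr) (dN x)).
  move/is_derive_eq; apply.
  have [eA eB eC eD] := solve x xr; have := N0 x xr.
  move: eA eB eC eD; rewrite /N.
  set E := A x * A' x + B x * B' x; set P := A x * B' x - B x * A' x.
  by move=> -> -> -> -> Nx; field.
have xx : ball x0 r x0 by exact: ballxx.
exists (U x0), (V x0); split.
  have Nx := N0 _ xx; rewrite /U /V /N.
  rewrite [LHS](_ : _ = (C x0 ^+ 2 + D x0 ^+ 2) / (A x0 ^+ 2 + B x0 ^+ 2)).
    by rewrite -eq_mod divff.
  by field.
move=> x xr; have Nx := N0 _ xr.
rewrite -(ball_derive0_cst dU xr) -(ball_derive0_cst dV xr).
by rewrite /U /V /N; split; field.
Qed.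

End Phase.

(** * Local choice between G = c F and G = c times the conjugate of F *)

Section PhaseDichotomy.
Context {R : realType}.
Variables A B A' B' C D C' D' : R -> R.
Hypothesis dA : forall x : R, is_derive x 1 A (A' x).
Hypothesis dB : forall x : R, is_derive x 1 B (B' x).
Hypothesis dC : forall x : R, is_derive x 1 C (C' x).
Hypothesis dD : forall x : R, is_derive x 1 D (D' x).
Hypothesis cA' : continuous A'.
Hypothesis cB' : continuous B'.
Hypothesis cC' : continuous C'.
Hypothesis cD' : continuous D'.
Hypothesis eq_mod : forall x, A x ^+ 2 + B x ^+ 2 = C x ^+ 2 + D x ^+ 2.
Hypothesis eq_mod' : forall x, A' x ^+ 2 + B' x ^+ 2 = C' x ^+ 2 + D' x ^+ 2.

(* The angular momenta P = Im (F' F^* ) and Q = Im (G' G^* ) have equal squares;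
   either they agree near x1, or P = - Q <> 0 at some nearby point, hence
   P = - Q near that point. *)
Lemma proportional_near (x1 : R) : A x1 ^+ 2 + B x1 ^+ 2 != 0 ->
  exists u v x0 : R, u ^+ 2 + v ^+ 2 = 1 /\
    ((\forall x \near x0, C x = u * A x - v * B x /\ D x = u * B x + v * A x) \/
     (\forall x \near x0, C x = u * A x + v * B x /\ D x = v * A x - u * B x)).
Proof.
move=> N1.
pose P x := A x * B' x - B x * A' x; pose Q x := C x * D' x - D x * C' x.
have cA := derive_continuous dA; have cB := derive_continuous dB.
have cC := derive_continuous dC; have cD := derive_continuous dD.
have eqPQ x : P x ^+ 2 = Q x ^+ 2.
  (* Lagrange's identity: both sides are |F|^2 |F'|^2 = |G|^2 |G'|^2. The radial terms agree, so
     they cancel. *)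
  have : P x ^+ 2 + (A x * A' x + B x * B' x) ^+ 2 =
         Q x ^+ 2 + (C x * C' x + D x * D' x) ^+ 2.
    rewrite [LHS](_ : _ = (A x ^+ 2 + B x ^+ 2) * (A' x ^+ 2 + B' x ^+ 2)); last first.
      by rewrite /P; ring.
    by rewrite eq_mod eq_mod' /Q; ring.
  by rewrite (eq_radial_derivative dA dB dC dD eq_mod) => /addIr.
have cN : continuous (fun x => A x * A x + B x * B x).
  by move=> x; apply: cvgD; apply: cvgM; by [exact: cA|exact: cB].
have cPQ : continuous (fun x => P x - Q x).
  move=> x; apply: cvgB; apply: cvgB; apply: cvgM;
    by [exact: cA|exact: cB|exact: cC|exact: cD|exact: cA'|exact: cB'|exact: cC'|exact: cD'].
have : \forall x \near x1, A x * A x + B x * B x != 0.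
  exact: cvgr_neq0 (cN x1) N1.
move=> /nbhs_ballP[r /= r0 Nr].
have [PQ|] := pselect (forall x : R, ball x1 r x -> P x = Q x).
  have [u [v [uv H]]] :=
    proportional_on_ball dA dB dC dD eq_mod r0 Nr PQ.
  exists u, v, x1; split => //; left.
  by apply/nbhs_ballP; exists r.
move=> /existsNP[x2] /not_implyP[x2r /eqP PQ2].
have : \forall x \near x2, P x - Q x != 0.
  by apply: cvgr_neq0 (cPQ x2) _; rewrite subr_eq0.
have x2N : \forall x \near x2, ball x1 r x.
  by apply: open_nbhs_nbhs; split => //; exact: ball_open.
move=> x2PQ; have /nbhs_ballP[s /= s0 Hs] : nbhs x2 (ball x1 r `&` [set x | P x - Q x != 0]).
  exact: filterI.
have dND (x : R) : is_derive x 1 (fun y => - D y) (- D' x) by exact: is_deriveN.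
(* Conjugating G keeps its modulus and reverses its angular momentum, which turns P = - Q into the
   equality required here. *)
have [|||u [v [uv H]]] := @proportional_on_ball R A B A' B' C (fun y => - D y)
  C' (fun y => - D' y) dA dB dC dND _ x2 s s0.
- by move=> x; rewrite sqrrN.
- by move=> x /Hs[/Nr].
- move=> x /Hs[_ PQx]; have /eqP := eqPQ x; rewrite eqf_sqr.
  rewrite -subr_eq0 (negbTE PQx)/= => /eqP; rewrite /P /Q => ->; ring.
(* The conjugate of G is (u + iv) F, so G is (u - iv) times the conjugate of F. *)
exists u, (- v), x2; split; first by rewrite sqrrN.
right; apply/nbhs_ballP; exists s => //= x /H[-> /eqP]; rewrite eqr_oppLR => /eqP ->.
by split; ring.
Qed.

End PhaseDichotomy.

(** * Injectivity of the Fourier transform *)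

Section FourierInjectivity.
Context {R : realType}.
Local Notation mu := (@leb R).
Implicit Types (a g h : R -> R) (s t x y r : R).

Lemma integrable_bddM a g (M : R) : mu.-integrable setT (EFin \o a) ->
    measurable_fun setT g -> (forall t, `|g t| <= M) ->
  mu.-integrable setT (EFin \o (fun t => a t * g t)).
Proof.
move=> ia mg gM.
have ma : measurable_fun setT a by apply/measurable_EFinP; case/integrableP: ia.
apply: (le_integrable measurableT _ _ (integrableZl measurableT M ia)).
  by apply/measurable_EFinP; exact: measurable_funM.
move=> t _ /=; rewrite lee_fin !normrM mulrC ler_wpM2r//.
exact: le_trans (gM t) (ler_norm _).
Qed.

Lemma measurable_sin_affine x s : measurable_fun setT (fun t => sin (x * t + s)).
Proof.
apply: continuous_measurable_fun => t.
apply: continuous_comp; last exact: continuous_sin.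
by apply: cvgD; [apply: cvgMl_tmp; exact: cvg_id|exact: cvg_cst].
Qed.

(* Bounded multipliers g such that every frequency of a * g vanishes; they form
   a module over the trigonometric polynomials. *)
Definition annihilator a g :=
  [/\ measurable_fun setT g, exists M : R, forall t, `|g t| <= M &
      forall x s, \int[mu]_t (a t * g t * sin (x * t + s)) = 0].

Lemma annihilator_integrable a g x s : mu.-integrable setT (EFin \o a) ->
  annihilator a g ->
  mu.-integrable setT (EFin \o (fun t => a t * g t * sin (x * t + s))).
Proof.
move=> ia [mg [M gM] _]; apply: (@integrable_bddM _ _ 1).
- exact: integrable_bddM gM.
- exact: measurable_sin_affine.
- by move=> t; exact: sin_max.
Qed.

Lemma annihilator_lin a g h (k l : R) : mu.-integrable setT (EFin \o a) ->
  annihilator a g -> annihilator a h ->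
  annihilator a (fun t => k * g t + l * h t).
Proof.
move=> ia ag ah; have [mg [M gM] g0] := ag; have [mh [N hN] h0] := ah; split.
- by apply: measurable_funD; exact: measurable_funM.
- exists (`|k| * M + `|l| * N) => t; apply: (le_trans (ler_normD _ _)).
  by rewrite !normrM lerD// ler_wpM2l.
- move=> x s; under eq_Rintegral do
    rewrite mulrDr mulrDl !(mulrCA (a _)) -!(mulrA k) -!(mulrA l).
  rewrite RintegralD//.
  + by rewrite !RintegralZl ?g0 ?h0 ?mulr0 ?addr0//; exact: annihilator_integrable.
  + exact: (integrableZl measurableT k (annihilator_integrable x s ia ag)).
  + exact: (integrableZl measurableT l (annihilator_integrable x s ia ah)).
Qed.

Lemma annihilator_sin a g y r : mu.-integrable setT (EFin \o a) ->
  annihilator a g -> annihilator a (fun t => g t * sin (y * t + r)).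
Proof.
move=> ia ag; have [mg [M gM] g0] := ag; split.
- by apply: measurable_funM => //; exact: measurable_sin_affine.
- exists M => t; rewrite normrM -[M]mulr1 ler_pM//; exact: sin_max.
- move=> x s.
  (* Product-to-sum formula; the shift by [pi / 2] writes the two cosines as sines, the form in
     which [annihilator] is stated. *)
  have E t : a t * (g t * sin (y * t + r)) * sin (x * t + s) =
     2^-1 * (a t * g t * sin ((x - y) * t + (s - r + pi / 2))) -
     2^-1 * (a t * g t * sin ((x + y) * t + (s + r + pi / 2))).
    rewrite !(addrA _ _ (pi / 2)) !sinDpihalf.
    rewrite (_ : (x - y) * t + (s - r) = (x * t + s) - (y * t + r)); last by ring.
    rewrite (_ : (x + y) * t + (s + r) = (x * t + s) + (y * t + r)); last by ring.
    by rewrite (cosB (x * t + s)) (cosD (x * t + s) (y * t + r)); field.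
  under eq_Rintegral do rewrite E.
  rewrite RintegralB//.
  + by rewrite !RintegralZl ?g0 ?mulr0 ?subr0//; exact: annihilator_integrable.
  + exact: (integrableZl measurableT _ (annihilator_integrable _ _ ia ag)).
  + exact: (integrableZl measurableT _ (annihilator_integrable _ _ ia ag)).
Qed.

(* The classical approximation (1 - p ^ N) ^ (2 ^ N) of the indicator function
   of p < 1/2, at p = (1 + z) / 2. *)
Definition step_poly (N : nat) (z : R) : R :=
  (1 - ((1 + z) / 2) ^+ N) ^+ (2 ^ N).

(* The frequency 1 / (n + 1) tends to 0, so that a single half-period survives in
   the limit, but slowly enough with respect to the degree (n + 1) ^ 2. *)
Definition halfline_approx s (n : nat) t : R :=
  step_poly (n.+1 ^ 2) (sin (n.+1%:R^-1 * t + - (n.+1%:R^-1 * s))).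

Lemma annihilator_step_poly a g y r N : mu.-integrable setT (EFin \o a) ->
  annihilator a g ->
  annihilator a (fun t => g t * step_poly N (sin (y * t + r))).
Proof.
move=> ia.
have half f : annihilator a f ->
    annihilator a (fun t => f t * ((1 + sin (y * t + r)) / 2)).
  move=> af; have := annihilator_lin 2^-1 2^-1 ia af (annihilator_sin y r ia af).
  by congr annihilator; apply/funext => t; field.
have pow k f : annihilator a f ->
    annihilator a (fun t => f t * ((1 + sin (y * t + r)) / 2) ^+ k).
  elim: k => [|k IH] af; first by under eq_fun do rewrite expr0 mulr1.
  by under eq_fun do rewrite exprSr mulrA; exact/half/IH.
rewrite /step_poly; move: (2 ^ N)%N => k ag; elim: k => [|k IH].
  by under eq_fun do rewrite expr0 mulr1.
have := annihilator_lin 1 (-1) ia IH (pow N _ IH).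
by congr annihilator; apply/funext => t; rewrite exprSr; ring.
Qed.

Lemma bernoulli_ineq (z : R) n : -1 <= z -> 1 + n%:R * z <= (1 + z) ^+ n.
Proof.
move=> z1; elim: n => [|n IH]; first by rewrite mul0r addr0 expr0.
have z0 : 0 <= 1 + z by lra.
have : (1 + n%:R * z) * (1 + z) <= (1 + z) ^+ n.+1.
  by rewrite exprSr ler_wpM2r.
apply: le_trans; rewrite -natr1; have : 0 <= n%:R * z ^+ 2 by rewrite mulr_ge0// sqr_ge0.
by lra.
Qed.

(** Bernoulli bounds [1 + n%:R * z] by (1 + z)^n, and (1 - z)^n (1 + z)^n = (1 - z^2)^n is at most
    1. *)
Lemma bernoulli_ineq_inv (z : R) n : 0 <= z <= 1 ->
  (1 - z) ^+ n * (1 + n%:R * z) <= 1.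
Proof.
move=> /andP[z0 z1].
have z0' : 0 <= 1 - z by lra.
have : (1 - z) ^+ n * (1 + n%:R * z) <= (1 - z) ^+ n * (1 + z) ^+ n.
  by rewrite ler_wpM2l ?exprn_ge0// bernoulli_ineq//; lra.
move=> /le_trans; apply; rewrite -exprMn exprn_ile1//; first by rewrite mulr_ge0//; lra.
have := sqr_ge0 z; lra.
Qed.

(** The threshold is at 0 because 2^N p = (1 + z)^N. For z >= 0, (1 - p)^(2^N) is at most 1 / (1 +
    2^N p), hence at most 1 / (1 + N z); for z <= 0, its distance to 1 is at most 2^N p, hence at
    most 1 / (1 - N z). *)
Lemma step_poly_bounds N (z : R) : -1 <= z <= 1 ->
  [/\ 0 <= step_poly N z <= 1, 0 <= z -> step_poly N z * (1 + N%:R * z) <= 1 &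
      z <= 0 -> (1 - step_poly N z) * (1 - N%:R * z) <= 1].
Proof.
move=> /andP[z1 z2]; pose p := ((1 + z) / 2) ^+ N.
have p0 : 0 <= p by rewrite exprn_ge0//; lra.
have p1 : p <= 1 by rewrite exprn_ile1//; lra.
have E : (2 ^ N)%:R * p = (1 + z) ^+ N.
  by rewrite natrX -exprMn; congr (_ ^+ _); field.
have q0 : 0 <= step_poly N z by rewrite exprn_ge0// subr_ge0.
have q1 : step_poly N z <= 1 by rewrite exprn_ile1// ?subr_ge0// gerBl.
split; first by rewrite q0.
- move=> z0; apply: le_trans (bernoulli_ineq_inv (2 ^ N) (z := p) _); last first.
    by rewrite p0.
  rewrite -/(step_poly N z) ler_wpM2l// E.
  by apply: (le_trans (bernoulli_ineq N z1)); rewrite lerDr.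
- move=> z0.
  have h : 1 - step_poly N z <= (1 + z) ^+ N.
    rewrite lerBlDr -lerBlDl -E.
    have := @bernoulli_ineq (- p) (2 ^ N); rewrite mulrN; apply; lra.
  have := @bernoulli_ineq_inv (- z) N; rewrite opprK mulrN.
  have -> : 0 <= - z <= 1 by lra.
  move=> /(_ isT); apply: le_trans.
  rewrite ler_wpM2r//; have : 0 <= N%:R * - z by rewrite mulr_ge0//; lra.
  lra.
Qed.

Lemma sin_ge_half_near0 :
  exists2 d : R, 0 < d & forall x, 0 < x -> x < d -> x / 2 <= sin x.
Proof.
have : \forall x \near (0 : R), 2^-1 < cos x.
  have /cvgr_gt : cos x @[x --> (0 : R)] --> cos (0 : R) by exact: continuous_cos.
  by apply; rewrite cos0 invf_lt1// ltr1n.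
move=> /nbhs_ballP[d /= d0 dcos]; exists d => // x x0 xd.
have x0' : 0 != x by rewrite lt_eqF.
have [c [_ cx]] := MVT_between (f := sin) (df := cos) x0' (fun y _ => is_derive_sin y).
rewrite sin0 !subr0 => ->; rewrite mulrC ler_wpM2r ?ltW//.
apply: dcos; rewrite /ball/= sub0r normrN; rewrite !subr0 in cx.
by apply: le_lt_trans cx _; rewrite gtr0_norm.
Qed.

(** Put m = n + 1 and v = |t - s|. For large m the sine has absolute value at least v / (2m), and
    the degree parameter m^2 turns this into an error of at most 2 / (v m). *)
Lemma halfline_approx_cvg s t : t != s ->
  halfline_approx s n t @[n --> \oo] --> ((t < s)%R%:R : R).
Proof.
move=> ts; pose v : R := `|t - s|.
have v0 : 0 < v by rewrite normr_gt0 subr_eq0.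
have [d d0 dsin] := sin_ge_half_near0.
have nv : \forall n \near \oo, n.+1%:R^-1 * v < d.
  have : (fun n : nat => n.+1%:R^-1 * v) @ \oo --> 0 * v.
    by apply: cvgMr_tmp; exact: cvg_harmonic.
  by rewrite mul0r => /cvgr_lt; apply.
apply/cvgrPdist_le => e e0.
have : (fun n : nat => 2 / v * n.+1%:R^-1) @ \oo --> 2 / v * 0.
  by apply: cvgMl_tmp; exact: cvg_harmonic.
rewrite mulr0 => /cvgr_le/(_ _ e0) ne.
near=> n; apply: (@le_trans _ _ (2 / v * n.+1%:R^-1)); last by near: n.
have nvd : n.+1%:R^-1 * v < d by near: n.
have n0 : 0 < n.+1%:R :> R by [].
have := dsin _ (mulr_gt0 (_ : 0 < n.+1%:R^-1) v0) nvd.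
rewrite invr_gt0 => /(_ n0) sv.
rewrite /halfline_approx -mulrBr; set z := sin _.
have zv : z = (if t < s then -1 else 1) * sin (n.+1%:R^-1 * v).
  rewrite /z /v; have [ts'|ts'|ts'] := ltgtP t s.
  - by rewrite ltr0_norm ?subr_lt0// mulrN sinN mulN1r opprK.
  - by rewrite gtr0_norm ?subr_gt0// mul1r.
  - by rewrite ts' eqxx in ts.
have [/andP[q0 q1] hp hn] := @step_poly_bounds (n.+1 ^ 2) z
  (introT andP (conj (sin_geN1 _) (sin_le1 _))).
move: hp hn zv q0 q1; set q := step_poly _ _ => hp hn zv q0 q1.
(* Used with [p := 1 - q] to the left of [s], where the limit is 1, and with [p := q] to the right,
   where it is 0. *)
have key (p : R) : 0 <= p ->
    p * (1 + (n.+1 ^ 2)%:R * sin (n.+1%:R^-1 * v)) <= 1 -> p <= 2 / v * n.+1%:R^-1.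
  have v1 : v != 0 := lt0r_neq0 v0.
  have n1 : n.+1%:R != 0 :> R := lt0r_neq0 n0.
  move=> p0 hp1; rewrite (_ : 2 / v / n.+1%:R = (2^-1 * (v * n.+1%:R))^-1); last first.
    by move: (n.+1%:R : R) n1 => m m1; field; rewrite v1 m1.
  rewrite -div1r ler_pdivlMr ?mulr_gt0//.
  apply: le_trans hp1; rewrite ler_wpM2l//.
  have : (n.+1 ^ 2)%:R * (n.+1%:R^-1 * v / 2) <=
         (n.+1 ^ 2)%:R * sin (n.+1%:R^-1 * v) by rewrite ler_wpM2l.
  rewrite [X in X <= _](_ : _ = 2^-1 * (v * n.+1%:R)).
    by lra.
  by rewrite natrX; move: (n.+1%:R : R) n1 => m m1; field.
have sp : 0 <= sin (n.+1%:R^-1 * v).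
  by apply: le_trans sv; rewrite !mulr_ge0// ?invr_ge0// ltW.
have [ts'|ts'] := ltP t s.
- rewrite ts' in zv; have := hn _; rewrite zv mulN1r mulrN opprK => hn1.
  by rewrite ger0_norm ?subr_ge0//; apply: key; [rewrite subr_ge0|apply: hn1; rewrite oppr_le0].
- rewrite (le_gtF ts') in zv.
  rewrite sub0r normrN ger0_norm//; apply: key => //.
  by have := hp _; rewrite zv mul1r; apply.
Unshelve. all: end_near. Qed.

Lemma annihilator_Rintegral_itvNy a s : mu.-integrable setT (EFin \o a) ->
  annihilator a (cst 1) -> \int[mu]_(t in `]-oo, s]) a t = 0.
Proof.
move=> ia a1.
have ma : measurable_fun setT a by apply/measurable_EFinP; case/integrableP: ia.
have aapprox n : annihilator a (halfline_approx s n).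
  have := annihilator_step_poly n.+1%:R^-1 (- (n.+1%:R^-1 * s)) (n.+1 ^ 2) ia a1.
  by congr annihilator; apply/funext => t; rewrite /= /cst mul1r.
have approx01 n t : 0 <= halfline_approx s n t <= 1.
  by have [] := @step_poly_bounds (n.+1 ^ 2) _
    (introT andP (conj (sin_geN1 (n.+1%:R^-1 * t + - (n.+1%:R^-1 * s))) (sin_le1 _))).
have [|||||_ _] := @dominated_convergence _ _ _ mu setT measurableT
  (fun n t => (a t * halfline_approx s n t)%:E) (EFin \o (a \_ `]-oo, s]))
  (EFin \o (fun t => `|a t|)).
- by move=> n; have [ms _ _] := aapprox n; apply/measurable_EFinP; exact: measurable_funM.
- by apply/measurable_EFinP/measurable_restrict => //; exact: measurable_funTS.
(* Pointwise convergence is known off [s] only, and a single point is negligible. *)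
- exists [set s]; split; [exact: measurable_set1|exact: lebesgue_measure_set1|].
  move=> t /=; apply: contra_notP => /eqP ts _.
  apply: cvg_EFin; first exact: nearW.
  have : a t * halfline_approx s n t @[n --> \oo] --> a t * (t < s)%R%:R.
    by apply: cvgM; [exact: cvg_cst|exact: halfline_approx_cvg].
  (* Outside the half-line the restriction of [a] takes the default value [point]. *)
  have p0 : point = 0 :> R by [].
  rewrite patchE mem_setE in_itv/= le_eqVlt (negbTE ts)/=.
  by case: ifP => _; rewrite ?p0 ?mulr1 ?mulr0.
- exact: integrable_norm.
- apply/aeW => t n _; have /andP[s0 s1] := approx01 n t.
  by rewrite lee_fin normrM (ger0_norm s0) ler_piMr.
have -> : (fun n => \int[mu]_t (a t * halfline_approx s n t)%:E)%E = cst 0%E.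
  (* Frequency 0 with phase [pi / 2] replaces the sine by 1. Integrability is then needed to pass
     from a zero [fine] value to a zero extended-real integral, since [fine] also sends infinities
     to 0. *)
  apply/funext => n /=; have [ms _ /(_ 0 (pi / 2))] := aapprox n.
  under eq_Rintegral do rewrite mul0r add0r sin_pihalf mulr1.
  have iapprox : mu.-integrable setT (EFin \o (fun t => a t * halfline_approx s n t)).
    apply: (@integrable_bddM _ _ 1) => // t; have /andP[s0 s1] := approx01 n t.
    by rewrite ger0_norm.
  by rewrite /Rintegral => /eqP; rewrite fine_eq0 ?integrable_fin_num// => /eqP.
move/cvg_lim => /(_ (@ereal_hausdorff R)); rewrite lim_cst// => E.
by rewrite Rintegral_mkcond /Rintegral -E.
Qed.

Lemma fourier_eq0_ae a : mu.-integrable setT (EFin \o a) ->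
    (forall x, \int[mu]_t (a t * cos (x * t)) = 0) ->
    (forall x, \int[mu]_t (a t * sin (x * t)) = 0) ->
  {ae mu, forall t, a t = 0}.
Proof.
move=> ia ca sa.
have bdM g : continuous g -> (forall t, `|g t| <= 1) ->
    mu.-integrable setT (EFin \o (fun t => a t * g t)).
  move=> cg g1; apply: (integrable_bddM ia) g1.
  exact: continuous_measurable_fun.
have cx x : continuous (fun t => x * t) by move=> t; apply: cvgMl_tmp; exact: cvg_id.
have ics x : mu.-integrable setT (EFin \o (fun t => a t * cos (x * t))).
  apply: bdM => [t|t]; last exact: cos_max.
  by apply: continuous_comp; [exact: cx|exact: continuous_cos].
have isn x : mu.-integrable setT (EFin \o (fun t => a t * sin (x * t))).
  apply: bdM => [t|t]; last exact: sin_max.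
  by apply: continuous_comp; [exact: cx|exact: continuous_sin].
have a1 : annihilator a (cst 1).
  split; first exact: measurable_cst.
    by exists 1 => t; rewrite /cst normr1.
  move=> x s; under eq_Rintegral do
    rewrite /cst mulr1 sinD mulrDr !mulrA.
  rewrite RintegralD//.
  - by rewrite !RintegralZr// ca sa !mul0r addr0.
  - exact: (integrableZr measurableT _ (isn x)).
  - exact: (integrableZr measurableT _ (ics x)).
have iNy y : mu.-integrable `]-oo, y] (EFin \o a) by apply: integrableS ia.
have la : locally_integrable setT a.
  have := integrable_locally measurableT ia.
  by rewrite (_ : a \_ setT = a)//; apply/funext => t; rewrite patchE in_setT.
(* Almost everywhere [a] is the derivative of its primitive from minus infinity, which is
   identically zero. *)
have := FTC1Ny iNy la.
have -> : (fun x => \int[mu]_(t in [set` `]-oo, x]]) a t) = cst 0.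
  by apply/funext => x; exact: annihilator_Rintegral_itvNy.
apply: filterS; first exact: (ae_filter_ringOfSetsType mu).
by move=> t [_ <-]; rewrite derive1_cst.
Qed.

End FourierInjectivity.

(** * Reflection of the Lebesgue measure *)

Section Reflection.
Context {R : realType}.
Local Notation mu := (@leb R).

Let measurable_oppr : measurable_fun setT (-%R : measurableTypeR R -> measurableTypeR R).
Proof. exact: oppr_measurable. Qed.

(** Lebesgue measure is its own pushforward under negation. The nonnegative case comes first because
    it yields the integrability needed for the signed one. *)
Lemma ge0_integral_opp (f : R -> R) : measurable_fun setT f ->
    (forall t, 0 <= f t) ->
  (\int[mu]_t (f (- t))%:E = \int[mu]_t (f t)%:E)%E.
Proof.
move=> mf f0.
have := @ge0_integral_pushforward _ _ _ _ R _ measurable_oppr mu setT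
  (EFin \o f) measurableT.
rewrite preimage_setT => <-.
- apply: eq_measure_integral => A mA _; exact: lebesgue_measureN.
- exact/measurable_EFinP.
- by move=> t _; rewrite lee_fin.
Qed.

Lemma integrable_opp (f : R -> R) : mu.-integrable setT (EFin \o f) ->
  mu.-integrable setT (EFin \o (fun t : R => f (- t))).
Proof.
move=> /integrableP[/measurable_EFinP mf lf].
have mf' : measurable_fun setT (fun t : R => f (- t)).
  exact: (measurableT_comp mf measurable_oppr).
apply/integrableP; split; first exact/measurable_EFinP.
move: lf => /=; rewrite -(@ge0_integral_opp (fun t : R => `|f t|))//.
exact: measurableT_comp.
Qed.

Lemma Rintegral_opp (f : R -> R) : mu.-integrable setT (EFin \o f) ->
  \int[mu]_t f (- t) = \int[mu]_t f t.
Proof.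
move=> intf; have mf : measurable_fun setT (EFin \o f) by case/integrableP: intf.
congr fine; have := @integral_pushforward _ _ _ _ R _ measurable_oppr mu setT
  (EFin \o f) mf (integrable_opp intf) measurableT.
rewrite preimage_setT => <-.
by apply: eq_measure_integral => A mA _; exact: lebesgue_measureN.
Qed.

End Reflection.

(** * Fourier integrals of superexponentially decaying functions *)

Section Oscillatory.
Context {R : realType}.
Local Notation mu := (@leb R).
Implicit Types (a b : R -> R) (t x y K : R).

(** This is what the Gaussian factor provides: a class stable under multiplication by t, whose
    Fourier integrals are entire. *)
Definition exp_integrable a := forall K,
  mu.-integrable setT (EFin \o (fun t => a t * expR (K * `|t|))).

Lemma exp_integrable_integrable a : exp_integrable a ->
  mu.-integrable setT (EFin \o a).
Proof.
move=> /(_ 0); congr (mu.-integrable _ _); apply/funext => t /=.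
by rewrite mul0r expR0 mulr1.
Qed.

Lemma exp_integrable_measurable a : exp_integrable a -> measurable_fun setT a.
Proof.
by move=> /exp_integrable_integrable/integrableP[/measurable_EFinP].
Qed.

Lemma measurable_expR_abs K : measurable_fun setT (fun t => expR (K * `|t|)).
Proof.
apply: measurableT_comp; first exact: measurable_expR.
by apply: measurable_funM => //; exact: measurable_normr.
Qed.

Lemma exp_integrable_le a b (C L : R) : exp_integrable a -> measurable_fun setT b ->
  (forall t, `|b t| <= C * (`|a t| * expR (L * `|t|))) -> exp_integrable b.
Proof.
move=> ea mb ab K.
apply: (le_integrable measurableT _ _ (integrableZl measurableT C (ea (L + K)))).
  by apply/measurable_EFinP; apply: measurable_funM => //; exact: measurable_expR_abs.
move=> t _ /=; rewrite lee_fin !normrM !(ger0_norm (expR_ge0 _)) mulrDl expRD.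
rewrite !mulrA ler_wpM2r ?expR_ge0// -mulrA; apply: (le_trans (ab t)).
by rewrite ler_wpM2r ?ler_norm// mulr_ge0// expR_ge0.
Qed.

Lemma exp_integrable_lin a b (k l : R) : exp_integrable a -> exp_integrable b ->
  exp_integrable (fun t => k * a t + l * b t).
Proof.
move=> ea eb K.
have := integrableD measurableT (integrableZl measurableT k (ea K))
  (integrableZl measurableT l (eb K)).
by congr (mu.-integrable _ _); apply/funext => t /=; rewrite mulrDl !EFinD !EFinM !muleA.
Qed.

Lemma exp_integrableN a : exp_integrable a -> exp_integrable (fun t => - a t).
Proof.
move=> ea; have := exp_integrable_lin (-1) 0 ea ea.
by congr exp_integrable; apply/funext => t; rewrite mul0r addr0 mulN1r.
Qed.

Lemma exp_integrable_mulx a (k : R) : exp_integrable a ->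
  exp_integrable (fun t => k * t * a t).
Proof.
(* The factor |t| is absorbed by e^|t|. *)
move=> ea; apply: (exp_integrable_le (C := `|k|) (L := 1) ea).
  apply: measurable_funM; last exact: exp_integrable_measurable.
  exact: measurable_funM.
move=> t; rewrite !normrM -mulrA ler_wpM2l// mulrC ler_wpM2l// mul1r.
by apply: le_trans (expR_ge1Dx _); rewrite lerDr.
Qed.

Lemma exp_integrable_opp a : exp_integrable a -> exp_integrable (fun t => a (- t)).
Proof.
move=> ea K; have := integrable_opp (ea K).
by congr (mu.-integrable _ _); apply/funext => t /=; rewrite normrN.
Qed.

(** The real part of the Fourier transform of a + ib; the imaginary part is
    [osc b (fun t => - a t)], so one real function serves for both. *)
Definition osc a b x : R :=
  \int[mu]_t (a t * cos (2 * pi * t * x) + b t * sin (2 * pi * t * x)).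

Lemma continuous_phase x : continuous (fun t : R => 2 * pi * t * x).
Proof.
move=> t; apply: cvgM; last exact: cvg_cst.
by apply: cvgM; [exact: cvg_cst|exact: cvg_id].
Qed.

Lemma integrable_cos a x : mu.-integrable setT (EFin \o a) ->
  mu.-integrable setT (EFin \o (fun t => a t * cos (2 * pi * t * x))).
Proof.
move=> ia; apply: (integrable_bddM ia (M := 1)) => [|t]; last exact: cos_max.
apply: continuous_measurable_fun => t.
by apply: continuous_comp; [exact: continuous_phase|exact: continuous_cos].
Qed.

Lemma integrable_sin a x : mu.-integrable setT (EFin \o a) ->
  mu.-integrable setT (EFin \o (fun t => a t * sin (2 * pi * t * x))).
Proof.
move=> ia; apply: (integrable_bddM ia (M := 1)) => [|t]; last exact: sin_max.
apply: continuous_measurable_fun => t.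
by apply: continuous_comp; [exact: continuous_phase|exact: continuous_sin].
Qed.

Lemma integrable_osc a b x : mu.-integrable setT (EFin \o a) ->
  mu.-integrable setT (EFin \o b) ->
  mu.-integrable setT (EFin \o (fun t =>
    a t * cos (2 * pi * t * x) + b t * sin (2 * pi * t * x))).
Proof.
move=> ia ib.
exact: (integrableD measurableT (integrable_cos x ia) (integrable_sin x ib)).
Qed.

Lemma oscE a b x : mu.-integrable setT (EFin \o a) ->
  mu.-integrable setT (EFin \o b) ->
  osc a b x = \int[mu]_t (a t * cos (2 * pi * t * x)) +
              \int[mu]_t (b t * sin (2 * pi * t * x)).
Proof.
move=> ia ib; rewrite /osc RintegralD//; [exact: integrable_cos|exact: integrable_sin].
Qed.

Lemma norm_osc_integrand a b t x :
  `|a t * cos (2 * pi * t * x) + b t * sin (2 * pi * t * x)| <= `|a t| + `|b t|.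
Proof.
apply: (le_trans (ler_normD _ _)); rewrite !normrM.
by apply: lerD; rewrite ler_piMr// ?cos_max ?sin_max.
Qed.

Lemma integrable_norm2 a b : mu.-integrable setT (EFin \o a) ->
  mu.-integrable setT (EFin \o b) ->
  mu.-integrable setT (EFin \o (fun t => `|a t| + `|b t|)).
Proof.
move=> ia ib.
exact: (integrableD measurableT (integrable_norm ia) (integrable_norm ib)).
Qed.

Lemma osc_derive a b x : exp_integrable a -> exp_integrable b ->
  is_derive x 1 (osc a b)
    (osc (fun t => 2 * pi * t * b t) (fun t => - (2 * pi * t * a t)) x).
Proof.
move=> ea eb.
pose f y t : R := a t * cos (2 * pi * t * y) + b t * sin (2 * pi * t * y).
pose df y t : R := 2 * pi * t * b t * cos (2 * pi * t * y) +
  - (2 * pi * t * a t) * sin (2 * pi * t * y).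
pose G t : R := `|2 * pi * t * b t| + `|- (2 * pi * t * a t)|.
have fdf y t : is_derive y 1 (f ^~ t) (df y t).
  have dl : is_derive y 1 (fun y => 2 * pi * t * y) (2 * pi * t).
    have := is_derive1M (is_derive_cst (2 * pi * t) y 1) (is_derive_id y 1).
    by move/is_derive_eq; apply; rewrite mulr0 addr0 mulr1.
  have dc : is_derive y 1 (fun y => cos (2 * pi * t * y))
      (- sin (2 * pi * t * y) * (2 * pi * t)).
    exact: (@is_derive1_comp R cos (fun y => 2 * pi * t * y)).
  have ds : is_derive y 1 (fun y => sin (2 * pi * t * y))
      (cos (2 * pi * t * y) * (2 * pi * t)).
    exact: (@is_derive1_comp R sin (fun y => 2 * pi * t * y)).
  have := is_derive1D (is_derive1M (is_derive_cst (a t) y 1) dc)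
                      (is_derive1M (is_derive_cst (b t) y 1) ds).
  by move/is_derive_eq; apply; rewrite /df /cst; ring.
have fd y t : derive1 (f ^~ t) y = df y t.
  by rewrite derive1E; have fy := fdf y t; rewrite derive_val.
have iG : mu.-integrable setT (EFin \o G).
  by apply: integrable_norm2; apply: exp_integrable_integrable;
    [exact: exp_integrable_mulx|exact/exp_integrableN/exp_integrable_mulx].
(* Any open interval around [x] would do, as the dominating function [G] does not depend on the
   frequency. *)
have Ix : `]x - 1, x + 1[%classic x by rewrite /= in_itv/=; apply/andP; split; lra.
have fint y : `]x - 1, x + 1[%classic y -> mu.-integrable setT (EFin \o f y).
  by move=> _; apply: integrable_osc; exact: exp_integrable_integrable.
have fder y t : `]x - 1, x + 1[%classic y -> setT t -> derivable (f ^~ t) y 1.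
  by move=> _ _; have [] := fdf y t.
have G0 t : 0 <= G t by rewrite addr_ge0.
have fG y t : `]x - 1, x + 1[%classic y -> setT t ->
    `|partial1of2 f y t| <= G t.
  move=> _ _; rewrite /partial1of2 fd.
  exact: (norm_osc_integrand (fun t => 2 * pi * t * b t)
                             (fun t => - (2 * pi * t * a t))).
apply: DeriveDef.
  exact: (derivable_under_integral measurableT Ix fint fder G0 iG fG).
rewrite -derive1E.
rewrite (differentiation_under_integral measurableT Ix fint fder G0 iG fG).
by apply: eq_Rintegral => t _; rewrite /partial1of2 fd.
Qed.

(** Multiplication of a + ib by -2 pi i t, which is one differentiation on the Fourier side. *)
Definition osc_rot (p : (R -> R) * (R -> R)) :=
  ((fun t => 2 * pi * t * p.2 t), (fun t => - (2 * pi * t * p.1 t))).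

Lemma osc_rot_exp_integrable n p : exp_integrable p.1 -> exp_integrable p.2 ->
  exp_integrable (iter n osc_rot p).1 /\ exp_integrable (iter n osc_rot p).2.
Proof.
move=> e1 e2; elim: n => [//|n [IH1 IH2]]; rewrite iterS/=; split.
  exact: exp_integrable_mulx.
exact/exp_integrableN/exp_integrable_mulx.
Qed.

Lemma osc_rot_norm n p t :
  `|(iter n osc_rot p).1 t| + `|(iter n osc_rot p).2 t| =
  (2 * pi * `|t|) ^+ n * (`|p.1 t| + `|p.2 t|).
Proof.
elim: n => [|n IH]; first by rewrite expr0 mul1r.
rewrite iterS/= normrN !normrM -mulrDr addrC IH.
by rewrite (ger0_norm (pi_ge0 R)) normr_nat exprS mulrA.
Qed.

Lemma exprn_le_fact_expR (y : R) n : 0 <= y -> y ^+ n <= n`!%:R * expR y.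
Proof.
move=> y0; case: n => [|n].
  by rewrite expr0 fact0 mul1r; apply: le_trans (expR_ge1Dx _); rewrite lerDl.
have f0 : 0 < n.+1`!%:R :> R by rewrite ltr0n fact_gt0.
rewrite -ler_pdivrMl// mulrC; apply: le_trans (expR_ge1Dxn n y0).
by rewrite lerDr.
Qed.

(** With L = 2 pi / K, (2 pi |t|)^n = K^n (L |t|)^n is at most K^n n! e^(L |t|); the constant is the
    integral of |a| + |b| against that exponential weight. *)
Lemma osc_derive_bound a b K : 0 < K -> exp_integrable a -> exp_integrable b ->
  exists C : R, forall n x,
    `|osc (iter n osc_rot (a, b)).1 (iter n osc_rot (a, b)).2 x|
    <= C * K ^+ n * n`!%:R.
Proof.
move=> K0 ea eb; pose L : R := 2 * pi / K.
pose w t : R := (`|a t| + `|b t|) * expR (L * `|t|).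
have iw : mu.-integrable setT (EFin \o w).
  have := integrable_norm2 (ea L) (eb L).
  congr (mu.-integrable _ _); apply/funext => t /=.
  by rewrite !normrM (ger0_norm (expR_ge0 _)) -mulrDl.
exists (\int[mu]_t w t) => n x.
have [e1 e2] := @osc_rot_exp_integrable n (a, b) ea eb.
have i1 := exp_integrable_integrable e1; have i2 := exp_integrable_integrable e2.
have io := integrable_osc x i1 i2.
apply: (le_trans (le_normr_Rintegral measurableT io)).
have -> : \int[mu]_t w t * K ^+ n * n`!%:R =
    \int[mu]_t (K ^+ n * n`!%:R * w t).
  by rewrite RintegralZl// [RHS]mulrC mulrA.
apply: le_Rintegral => //.
- exact: integrable_norm.
- exact: (integrableZl measurableT _ iw).
move=> t _; apply: (le_trans (norm_osc_integrand _ _ _ _)).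
rewrite osc_rot_norm/= /w [X in _ <= _ * X]mulrC [leRHS]mulrA ler_wpM2r ?addr_ge0//.
have -> : 2 * pi * `|t| = K * (L * `|t|).
  by rewrite /L; field; exact: lt0r_neq0.
rewrite exprMn -[leRHS]mulrA ler_wpM2l ?exprn_ge0 ?(ltW K0)//.
by apply: exprn_le_fact_expR; rewrite !mulr_ge0 ?invr_ge0 ?pi_ge0// ltW.
Qed.

Lemma osc_vanish_near a b x0 : exp_integrable a -> exp_integrable b ->
  (\forall x \near x0, osc a b x = 0) -> forall x, osc a b x = 0.
Proof.
move=> ea eb ab0.
apply: (@vanish_near_entire R
  (fun n => osc (iter n osc_rot (a, b)).1 (iter n osc_rot (a, b)).2) x0) => //.
- move=> n x; have [e1 e2] := @osc_rot_exp_integrable n (a, b) ea eb.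
  exact: osc_derive.
- by move=> K K0; exact: osc_derive_bound.
Qed.

Lemma integrable_oppf a : mu.-integrable setT (EFin \o a) ->
  mu.-integrable setT (EFin \o (fun t => - a t)).
Proof. by move=> ia; exact: (integrableN ia). Qed.

Lemma oscN a b x : mu.-integrable setT (EFin \o a) ->
  mu.-integrable setT (EFin \o b) ->
  osc a b (- x) = \int[mu]_t (a t * cos (2 * pi * t * x)) -
                  \int[mu]_t (b t * sin (2 * pi * t * x)).
Proof.
move=> ia ib; rewrite -RintegralB//; [|exact: integrable_cos|exact: integrable_sin].
by apply: eq_Rintegral => t _; rewrite mulrN cosN sinN mulrN.
Qed.

Lemma osc_inj a b : mu.-integrable setT (EFin \o a) ->
    mu.-integrable setT (EFin \o b) -> (forall x, osc a b x = 0) ->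
    (forall x, osc b (fun t => - a t) x = 0) ->
  {ae mu, forall t, a t = 0}.
Proof.
move=> ia ib ab0 ba0.
have iNa := integrable_oppf ia.
have pi0 : 2 * pi != 0 :> R by rewrite mulf_neq0// gt_eqF// pi_gt0.
have xy x t : x * t = 2 * pi * t * (x / (2 * pi)).
  by move: (2 * pi : R) pi0 => c c0; field.
apply: fourier_eq0_ae => // x.
- under eq_Rintegral => t _ do rewrite (xy x).
  (* Opposite frequencies give the sum and the difference of the cosine and sine integrals, so both
     vanish. *)
  by have := ab0 (x / (2 * pi)); have := ab0 (- (x / (2 * pi))); rewrite oscN// oscE//; lra.
- under eq_Rintegral => t _ do rewrite (xy x) -[a t]opprK mulNr -mulN1r.
  rewrite RintegralZl//; last exact: integrable_sin.
  by have := ba0 (x / (2 * pi)); have := ba0 (- (x / (2 * pi))); rewrite oscN// oscE//; lra.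
Qed.

End Oscillatory.

(** * Complex-valued Fourier transforms *)

Section ComplexFourier.
Context {R : realType}.
Local Notation mu := (@leb R).
Implicit Types (h k : R -> R[i]) (t x : R) (c : R[i]).

Lemma osc_lin (a1 a2 b1 b2 : R -> R) (k l x : R) :
    mu.-integrable setT (EFin \o a1) -> mu.-integrable setT (EFin \o b1) ->
    mu.-integrable setT (EFin \o a2) -> mu.-integrable setT (EFin \o b2) ->
  osc (fun t => k * a1 t + l * a2 t) (fun t => k * b1 t + l * b2 t) x =
  k * osc a1 b1 x + l * osc a2 b2 x.
Proof.
move=> ia1 ib1 ia2 ib2.
have i1 := integrable_osc x ia1 ib1; have i2 := integrable_osc x ia2 ib2.
rewrite /osc -!RintegralZl// -RintegralD//.
- by apply: eq_Rintegral => t _; ring.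
- exact: (integrableZl measurableT k i1).
- exact: (integrableZl measurableT l i2).
Qed.

Lemma osc_opp (a b : R -> R) x :
    mu.-integrable setT (EFin \o a) -> mu.-integrable setT (EFin \o b) ->
  osc (fun t => - a t) (fun t => - b t) x = - osc a b x.
Proof.
move=> ia ib; rewrite /osc -mulN1r -RintegralZl//; last exact: integrable_osc.
by apply: eq_Rintegral => t _; ring.
Qed.

Definition Cexp_integrable h :=
  exp_integrable (fun t => complex.Re (h t)) /\
  exp_integrable (fun t => complex.Im (h t)).

Lemma fourierE h x : fourier h x =
  Complex (osc (fun t => complex.Re (h t)) (fun t => complex.Im (h t)) x)
          (osc (fun t => complex.Im (h t)) (fun t => - complex.Re (h t)) x).
Proof.
by rewrite /fourier /osc; congr Complex; apply: eq_Rintegral => t _; rewrite mulNr.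
Qed.

Lemma Re_rmulf (g : R -> R) h t : complex.Re (rmulf g h t) = g t * complex.Re (h t).
Proof. by rewrite /rmulf; case: (h t) => u v /=; rewrite mul0r subr0. Qed.

Lemma Im_rmulf (g : R -> R) h t : complex.Im (rmulf g h t) = g t * complex.Im (h t).
Proof. by rewrite /rmulf; case: (h t) => u v /=; rewrite mul0r addr0. Qed.

(** The weighted product u G satisfies |u G| <= u^2 + G^2, and both squares have integrable
    bounds. *)
Lemma exp_integrable_gauss (u w : R -> R) : measurable_fun setT u ->
    mu.-integrable setT (EFin \o w) -> (forall t, u t ^+ 2 <= w t) ->
  exp_integrable (fun t => gamma1 t * u t).
Proof.
move=> mu0 iw uw K.
have ig := integrableZl measurableT (expR (K ^+ 2)) (@integrableT_gauss R).
apply: (le_integrable measurableT _ _ (integrableD measurableT iw ig)).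
  apply/measurable_EFinP; apply: measurable_funM; last exact: measurable_expR_abs.
  apply: measurable_funM => //; apply: measurableT_comp; first exact: measurable_expR.
  by apply: measurableT_comp => //; apply: measurable_funM => //.
move=> t _ /=; rewrite lee_fin; set E := gauss_fun t.
have w0 : 0 <= w t by apply: le_trans (uw t); exact: sqr_ge0.
have g0 : 0 <= expR (K ^+ 2) * E by rewrite mulr_ge0 ?expR_ge0.
rewrite (ger0_norm (addr_ge0 w0 g0)).
pose G : R := expR (- (pi * t ^+ 2) + K * `|t|).
have -> : gamma1 t * u t * expR (K * `|t|) = u t * G.
  by rewrite /gamma1 /G expRD; ring.
(* Here 2 K |t| <= K^2 + t^2, and pi >= 1 leaves at least the decay e^(-t^2) of [gauss_fun]. *)
have GE : G ^+ 2 <= expR (K ^+ 2) * E.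
  rewrite /G /E /gauss_fun -expRM_natl -expRD ler_expR.
  have := sqr_ge0 (K - `|t|); rewrite sqrrB real_normK ?num_real// => h.
  have : t ^+ 2 <= pi * t ^+ 2.
    by rewrite ler_peMl ?sqr_ge0//; apply: le_trans (pi_ge2 R); lra.
  move: h; rewrite mulr2n; lra.
rewrite normrM (ger0_norm (expR_ge0 _ : 0 <= G)).
have := sqr_ge0 (`|u t| - G); have := uw t; have := sqr_ge0 (u t).
by rewrite -(real_normK (num_real (u t))); nra.
Qed.

Lemma isL2_Cexp_integrable h : isL2 h -> Cexp_integrable (rmulf (@gamma1 R) h).
Proof.
move=> [m1 m2 i12].
pose w t : R := complex.Re (h t) ^+ 2 + complex.Im (h t) ^+ 2.
have iw : mu.-integrable setT (EFin \o w).
  apply/integrableP; split.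
    apply/measurable_EFinP; apply: measurable_funD; exact: measurable_funX.
  move: i12; congr (_ < _)%E; apply: eq_integral => t _ /=.
  by rewrite ger0_norm// addr_ge0// sqr_ge0.
split.
- under eq_fun do rewrite Re_rmulf.
  by apply: exp_integrable_gauss iw _ => // t; rewrite lerDl sqr_ge0.
- under eq_fun do rewrite Im_rmulf.
  by apply: exp_integrable_gauss iw _ => // t; rewrite lerDr sqr_ge0.
Qed.

(** The nested combinations with coefficients [1] match the shape of [exp_integrable_lin] and
    [osc_lin]. *)
Lemma Re_subM h k c t : complex.Re (k t - c * h t) = 1 * complex.Re (k t) +
  1 * (- complex.Re c * complex.Re (h t) + complex.Im c * complex.Im (h t)).
Proof. by case: c (h t) (k t) => u v [a b] [a' b'] /=; ring. Qed.

Lemma Im_subM h k c t : complex.Im (k t - c * h t) = 1 * complex.Im (k t) +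
  1 * (- complex.Re c * complex.Im (h t) + complex.Im c * - complex.Re (h t)).
Proof. by case: c (h t) (k t) => u v [a b] [a' b'] /=; ring. Qed.

Lemma Cexp_integrable_subM h k c : Cexp_integrable h -> Cexp_integrable k ->
  Cexp_integrable (fun t => k t - c * h t).
Proof.
move=> [h1 h2] [k1 k2]; split.
- under eq_fun do rewrite Re_subM.
  by do 2 apply: exp_integrable_lin => //.
- under eq_fun do rewrite Im_subM.
  by do 2 apply: exp_integrable_lin => //; exact: exp_integrableN.
Qed.

Lemma fourier_subM h k c x : Cexp_integrable h -> Cexp_integrable k ->
  fourier (fun t => k t - c * h t) x = fourier k x - c * fourier h x.
Proof.
move=> [/exp_integrable_integrable h1 /exp_integrable_integrable h2].
move=> [/exp_integrable_integrable k1 /exp_integrable_integrable k2].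
have h1N := integrable_oppf h1; have k1N := integrable_oppf k1.
rewrite !fourierE.
set a := fun t => complex.Re (h t); set b := fun t => complex.Im (h t).
set p := fun t => complex.Re (k t); set q := fun t => complex.Im (k t).
have lin (a1 a2 : R -> R) (l m : R) :
    mu.-integrable setT (EFin \o a1) -> mu.-integrable setT (EFin \o a2) ->
    mu.-integrable setT (EFin \o (fun t => l * a1 t + m * a2 t)).
  move=> i1 i2.
  exact: (integrableD measurableT (integrableZl measurableT l i1)
                                  (integrableZl measurableT m i2)).
pose u := complex.Re c; pose v := complex.Im c.
have E1 : osc (fun t => complex.Re (k t - c * h t))
              (fun t => complex.Im (k t - c * h t)) x =
    1 * osc p q x + 1 * (- u * osc a b x + v * osc b (fun t => - a t) x).
  rewrite -osc_lin// -osc_lin//; [|exact: lin..].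
  by congr osc; apply/funext => t; [exact: Re_subM|exact: Im_subM].
have E2 : osc (fun t => complex.Im (k t - c * h t))
              (fun t => - complex.Re (k t - c * h t)) x =
    1 * osc q (fun t => - p t) x +
    1 * (- u * osc b (fun t => - a t) x + - v * osc a b x).
  rewrite -osc_lin// -osc_lin//; [|exact: lin..].
  by congr osc; apply/funext => t; rewrite ?Re_subM ?Im_subM /p /q /a /b /u /v; ring.
rewrite E1 E2 /u /v; case: c {E1 E2 u v} => u v.
by apply/eqP; rewrite eq_complex; apply/andP; split; apply/eqP => /=; ring.
Qed.

(** Local vanishing suffices: both parts of the transform are entire, hence vanish on the whole
    line, where injectivity applies. *)
Lemma Cfourier_inj h x0 : Cexp_integrable h ->
  (\forall x \near x0, fourier h x = 0) -> {ae mu, forall t, h t = 0}.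
Proof.
move=> [h1 h2] h0.
have i1 := exp_integrable_integrable h1; have i2 := exp_integrable_integrable h2.
have e1 x : osc (fun t => complex.Re (h t)) (fun t => complex.Im (h t)) x = 0.
  apply: (osc_vanish_near h1 h2 (x0 := x0)).
  by apply: filterS h0 => y; rewrite fourierE => -[].
have e2 x : osc (fun t => complex.Im (h t)) (fun t => - complex.Re (h t)) x = 0.
  apply: (osc_vanish_near h2 (exp_integrableN h1) (x0 := x0)).
  by apply: filterS h0 => y; rewrite fourierE => -[].
have z1 := osc_inj i1 i2 e1 e2.
have z2 : {ae mu, forall t, complex.Im (h t) = 0}.
  apply: (osc_inj i2 (integrable_oppf i1) e2) => x.
  by rewrite osc_opp// e1 oppr0.
have aeF := ae_filter_ringOfSetsType mu.
by apply: filterS2 z1 z2 => t; case: (h t) => u v /= -> ->.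
Qed.

Lemma fourier_reflconj h x : Cexp_integrable h ->
  fourier (reflconj h) x = conjc (fourier h x).
Proof.
move=> [/exp_integrable_integrable i1 /exp_integrable_integrable i2].
have Re_refl t : complex.Re (reflconj h t) = complex.Re (h (- t)).
  by rewrite /reflconj; case: (h (- t)).
have Im_refl t : complex.Im (reflconj h t) = - complex.Im (h (- t)).
  by rewrite /reflconj; case: (h (- t)).
have phase t : 2 * pi * - t * x = - (2 * pi * t * x) by ring.
rewrite !fourierE /=; congr Complex.
- rewrite -[RHS](Rintegral_opp (integrable_osc x i1 i2)).
  by apply: eq_Rintegral => t _; rewrite Re_refl Im_refl phase cosN sinN; ring.
- rewrite -osc_opp//; last exact: integrable_oppf.
  have iN := integrable_osc x (integrable_oppf i2) (integrable_oppf (integrable_oppf i1)).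
  rewrite -[RHS](Rintegral_opp iN).
  by apply: eq_Rintegral => t _; rewrite Re_refl Im_refl phase cosN sinN; ring.
Qed.

End ComplexFourier.

(** * From Gaussian-windowed transforms back to the functions *)

Section Recovery.
Context {R : realType}.
Local Notation mu := (@leb R).
Implicit Types (phi psi : R -> R[i]).

Lemma sqr_Re_Im_eq_norm (z w : R[i]) : `|z| = `|w| ->
  complex.Re z ^+ 2 + complex.Im z ^+ 2 = complex.Re w ^+ 2 + complex.Im w ^+ 2.
Proof. by move=> E; apply/complexI; rewrite !add_Re2_Im2 E. Qed.

(** The transform of [gamma2] times [phi] is iF', so its parts are those of F' swapped up to sign.
    The right-hand side is |F'|^2 in the form that [osc_derive] produces. *)
Lemma fourier_gamma2 phi x : Cexp_integrable (rmulf (@gamma1 R) phi) ->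
  let a t := complex.Re (rmulf (@gamma1 R) phi t) in
  let b t := complex.Im (rmulf (@gamma1 R) phi t) in
  complex.Re (fourier (rmulf (@gamma2 R) phi) x) ^+ 2 +
  complex.Im (fourier (rmulf (@gamma2 R) phi) x) ^+ 2 =
  osc (fun t => 2 * pi * t * b t) (fun t => - (2 * pi * t * a t)) x ^+ 2 +
  osc (fun t => 2 * pi * t * - a t) (fun t => - (2 * pi * t * b t)) x ^+ 2.
Proof.
move=> [ea eb] a b.
have Ra t : complex.Re (rmulf (@gamma2 R) phi t) = 2 * pi * t * a t.
  by rewrite /a !Re_rmulf /gamma2 /gamma1 mulrA.
have Ib t : complex.Im (rmulf (@gamma2 R) phi t) = 2 * pi * t * b t.
  by rewrite /b !Im_rmulf /gamma2 /gamma1 mulrA.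
rewrite fourierE/= (funext Ra) (funext Ib) addrC; congr (_ ^+ 2 + _).
  by congr osc; apply/funext => t; rewrite Ra.
rewrite -[LHS]sqrrN -osc_opp; [|exact/exp_integrable_integrable/exp_integrable_mulx..].
by congr (osc _ _ _ ^+ 2); apply/funext => t; rewrite mulrN.
Qed.

(** By linearity the transform of [gamma1] times psi - c phi vanishes near [x0]; the Gaussian has no
    zero and can be divided out. *)
Lemma ae_eq_of_fourier phi psi (c : R[i]) (x0 : R) :
    Cexp_integrable (rmulf (@gamma1 R) phi) ->
    Cexp_integrable (rmulf (@gamma1 R) psi) ->
    (\forall x \near x0, fourier (rmulf (@gamma1 R) psi) x =
                         c * fourier (rmulf (@gamma1 R) phi) x) ->
  {ae mu, forall x, psi x = c * phi x}.
Proof.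
move=> ephi epsi E.
have E0 : \forall x \near x0, fourier (fun t => rmulf (@gamma1 R) psi t -
    c * rmulf (@gamma1 R) phi t) x = 0.
  by apply: filterS E => x Ex; rewrite fourier_subM// Ex subrr.
have := Cfourier_inj (Cexp_integrable_subM c ephi epsi) E0.
apply: filterS; first exact: (ae_filter_ringOfSetsType mu).
move=> t; rewrite /rmulf mulrCA -mulrBr => /eqP; rewrite mulf_eq0 => /orP[/eqP[]|].
  by move=> /eqP; rewrite gt_eqF// expR_gt0.
by rewrite subr_eq0 => /eqP.
Qed.

Lemma rmulf_reflconj phi :
  rmulf (@gamma1 R) (reflconj phi) = reflconj (rmulf (@gamma1 R) phi).
Proof.
apply/funext => t; rewrite /rmulf /reflconj rmorphM/= /gamma1 sqrrN.
by rewrite oppr0.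
Qed.

Lemma Cexp_integrable_reflconj (h : R -> R[i]) :
  Cexp_integrable h -> Cexp_integrable (reflconj h).
Proof.
move=> [h1 h2]; split.
- have := exp_integrable_opp h1; congr exp_integrable; apply/funext => t.
  by rewrite /reflconj; case: (h (- t)).
- have := exp_integrable_opp (exp_integrableN h2).
  by congr exp_integrable; apply/funext => t; rewrite /reflconj; case: (h (- t)).
Qed.

End Recovery.

Theorem mainTheorem1 (R : realType) (phi psi : R -> R[i]) :
  isL2 phi -> isL2 psi ->
  (forall xi : R, `|fourier (rmulf (@gamma1 R) phi) xi|
                  = `|fourier (rmulf (@gamma1 R) psi) xi|) ->
  (forall xi : R, `|fourier (rmulf (@gamma2 R) phi) xi|
                  = `|fourier (rmulf (@gamma2 R) psi) xi|) ->
  exists c : R[i], `|c| = 1 /\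
    ({ae (@leb R), forall x, psi x = c * phi x}
     \/ {ae (@leb R), forall x, psi x = c * reflconj phi x}).
Proof.
move=> /isL2_Cexp_integrable ephi /isL2_Cexp_integrable epsi eq1 eq2.
(* The phase argument needs a point where F does not vanish. If F is zero, so is G, and [c = 1]
   works. *)
have [F0|] := pselect (forall x, fourier (rmulf (@gamma1 R) phi) x = 0).
  exists 1; split; first exact: normr1.
  left; apply: (ae_eq_of_fourier (x0 := 0) ephi epsi).
  apply: filterE => x; rewrite F0 mulr0; apply/normr0_eq0.
  by rewrite -eq1 F0 normr0.
move=> /existsNP[x1 /eqP F1].
have [a1 b1] := ephi; have [a2 b2] := epsi.
(* The derivatives are continuous because they are Fourier integrals that can be differentiated once
   more. *)
have cont (a b : R -> R) : exp_integrable a -> exp_integrable b ->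
    continuous (osc (fun t => 2 * pi * t * b t) (fun t => - (2 * pi * t * a t))).
  move=> ea eb; apply: derive_continuous => x; apply: osc_derive.
    exact: exp_integrable_mulx.
  exact/exp_integrableN/exp_integrable_mulx.
have [|||u [v [x0 [uv H]]]] := @proportional_near R _ _ _ _ _ _ _ _
  (fun x => osc_derive x a1 b1) (fun x => osc_derive x b1 (exp_integrableN a1))
  (fun x => osc_derive x a2 b2) (fun x => osc_derive x b2 (exp_integrableN a2))
  (cont _ _ a1 b1) (cont _ _ b1 (exp_integrableN a1))
  (cont _ _ a2 b2) (cont _ _ b2 (exp_integrableN a2)) _ _ x1.
- by move=> x; have := sqr_Re_Im_eq_norm (eq1 x); rewrite !fourierE.
- move=> x; have := sqr_Re_Im_eq_norm (eq2 x).
  by rewrite (fourier_gamma2 x ephi) (fourier_gamma2 x epsi).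
- apply: contraNneq F1 => E; rewrite fourierE; apply/eqP.
  move: E => /eqP; rewrite paddr_eq0 ?sqr_ge0// !sqrf_eq0.
  by move=> /andP[/eqP -> /eqP ->].
exists (Complex u v); split; first by rewrite normc_def/= uv sqrtr1.
case: H => H; [left|right].
- apply: (ae_eq_of_fourier (x0 := x0) ephi epsi).
  apply: filterS H => x [H1 H2]; rewrite !fourierE H1 H2.
  by apply/eqP; rewrite eq_complex; apply/andP; split; apply/eqP => /=; ring.
(* The Gaussian is real and even, so the conjugate of F is the transform of [gamma1] times
   [reflconj phi], which takes the place of [phi]. *)
- have erefl : Cexp_integrable (rmulf (@gamma1 R) (reflconj phi)).
    by rewrite rmulf_reflconj; exact: Cexp_integrable_reflconj.
  apply: (ae_eq_of_fourier (x0 := x0) erefl epsi).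
  apply: filterS H => x [H1 H2].
  rewrite rmulf_reflconj fourier_reflconj// !fourierE H1 H2.
  by apply/eqP; rewrite eq_complex; apply/andP; split; apply/eqP => /=; ring.
Qed.
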